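(* Let $k\ge 3$ and $\omega=\cos(2\pi/k)+\mathbf{i}\sin(2\pi/k)$. Let $G$ be a connected simple graph of order $n$ and let $M_{G_1}$ be a mixed graph whose underlying graph $G_1$ is a spanning subgraph of $G$. Then the following are equivalent: (a) $G$ and $M_{G_1}$ are cospectral; (b) $\lambda_1(G)=\lambda_1(M_{G_1})$; (c) $G_1=G$, and $V(M_{G_1})$ has a partition $V_1\cup V_2\cup\cdots\cup V_k$ such that every undirected edge $uv$ of $M_{G_1}$ satisfies $u,v\in V_j$ for some $j\in\{1,\dots,k\}$, and every arc from $u$ to $v$ of $M_{G_1}$ satisfies $u\in V_r$, $v\in V_s$ for some $r,s\in\{1,\dots,k\}$ with $r-s\equiv 1\pmod k$; (d) $G$ and $M_{G_1}$ are switching equivalent.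
   Context: A mixed graph $M_G$ is obtained from a simple graph $G$ by leaving some edges undirected and replacing each other edge by an arc; a simple graph is regarded as a mixed graph with all edges undirected. The Hermitian adjacency matrix $H(M_G)=(h_{uv})$ has $h_{uv}=\omega$ if there is an arc from $u$ to $v$, $h_{uv}=\overline{\omega}$ if there is an arc from $v$ to $u$, $h_{uv}=1$ if $uv$ is an undirected edge, and $0$ otherwise (for a simple graph this is its adjacency matrix). Cospectral means the Hermitian adjacency matrices have the same eigenvalues with multiplicities; $\lambda_1(\cdot)$ denotes the largest eigenvalue of the Hermitian adjacency matrix. Given a partition $V(M_G)=V_1\cup\cdots\cup V_k$ (possibly empty parts), an arc from $x$ to $y$, or an undirected edge $\{x,y\}$, is of type $(\omega^i,\omega^j)$ if $x\in V_i$, $y\in V_j$. The partition is admissible if every undirected edge is of some type $(\omega^i,\omega^j)$ with $j-i\equiv 0,\pm1\pmod k$ and every arc is of some type $(\omega^i,\omega^j)$ with $i-j\equiv 0,1,2\pmod k$. A three-way switching with respect to an admissible partition: (i) replaces each undirected edge $\{x,y\}$ of type $(\omega^i,\omega^j)$ with $j-i\equiv1\pmod k$ by the arc from $x$ to $y$; (ii) replaces each arc of type $(\omega^i,\omega^j)$ with $i-j\equiv 1\pmod k$ by an undirected edge; (iii) reverses each arc of type $(\omega^i,\omega^j)$ with $i-j\equiv2\pmod k$; everything else is unchanged. The converse of a mixed graph is obtained by reversing all its arcs. Two mixed graphs are switching equivalent if one can be turned into the other by a finite sequence of three-way switchings (with respect to admissible partitions) and operations of taking the converse. *)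

(* Defs.v *)
From HB Require Import structures.
From Stdlib Require Import Relation_Operators.
From mathcomp Require Import all_boot all_order all_algebra.
From mathcomp Require Import complex reals trigo.

Set Implicit Arguments.
Unset Strict Implicit.
Unset Printing Implicit Defensive.

Import Order.TTheory GRing.Theory Num.Theory.

Local Open Scope ring_scope.
Local Open Scope complex_scope.

Record simple_graph (T : finType) := SimpleGraph {
  adj : rel T;
  adj_sym : symmetric adj;
  adj_irr : irreflexive adj
}.

(* [uedge] holds for the undirected edges and [darc u v] for an arc from u to v;
   any two vertices are joined by at most one undirected edge or arc. *)
Record mixed_graph (T : finType) := MixedGraph {
  uedge : rel T;
  darc : rel T;
  uedge_sym : symmetric uedge;
  uedge_irr : irreflexive uedge;
  darc_irr : irreflexive darc;
  darc_asym : forall u v, darc u v -> ~~ darc v u;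
  uedge_not_darc : forall u v, uedge u v -> ~~ darc u v
}.

Section Graphs.
Variable T : finType.
Implicit Types (G : simple_graph T) (M N : mixed_graph T).

Definition mixed_of_simple G : mixed_graph T :=
  @MixedGraph T (adj G) (fun _ _ => false) (adj_sym G) (adj_irr G)
    (fun _ => erefl) (fun _ _ _ => isT) (fun _ _ _ => isT).

Definition underlying_adj M : rel T :=
  fun u v => [|| uedge M u v, darc M u v | darc M v u].

Lemma underlying_adj_sym M : symmetric (underlying_adj M).
Proof. by move=> u v; rewrite /underlying_adj uedge_sym [darc M u v || _]orbC. Qed.

Lemma underlying_adj_irr M : irreflexive (underlying_adj M).
Proof. by move=> u; rewrite /underlying_adj uedge_irr darc_irr. Qed.

Definition underlying M : simple_graph T :=
  SimpleGraph (underlying_adj_sym M) (underlying_adj_irr M).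

Definition spanning_subgraph G1 G : Prop := subrel (adj G1) (adj G).

Definition same_graph G1 G : Prop := adj G1 =2 adj G.

Definition connected_graph G : Prop :=
  (0 < #|T|)%N /\ forall u v, connect (adj G) u v.

Definition converse_of M N : Prop :=
  uedge N =2 uedge M /\ forall u v, darc N u v = darc M v u.

(* A partition V_1, ..., V_k into possibly empty labelled parts is given by the
   map p sending each vertex to the index of its part. Indices start at 0
   instead of 1: only differences of indices modulo k matter. *)
Section Switching.
Variable k : nat.
Implicit Type p : T -> 'I_k.

Definition part_diff p (u v : T) (d : nat) : bool :=
  (p u == p v + d %[mod k])%N.

Definition admissible p M : Prop :=
  (forall x y, uedge M x y ->
     [|| part_diff p y x 0, part_diff p y x 1 | part_diff p x y 1]) /\
  (forall x y, darc M x y ->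
     [|| part_diff p x y 0, part_diff p x y 1 | part_diff p x y 2]).

Definition three_way_switching p M N : Prop :=
  [/\ admissible p M,
      forall x y, uedge N x y =
        [|| [&& uedge M x y, ~~ part_diff p y x 1 & ~~ part_diff p x y 1],
            darc M x y && part_diff p x y 1
          | darc M y x && part_diff p y x 1]
    & forall x y, darc N x y =
        [|| uedge M x y && part_diff p y x 1,
            [&& darc M x y, ~~ part_diff p x y 1 & ~~ part_diff p x y 2]
          | darc M y x && part_diff p y x 2]].

Definition switching_step M N : Prop :=
  (exists p : T -> 'I_k, three_way_switching p M N) \/ converse_of M N.

Definition switching_reachable : mixed_graph T -> mixed_graph T -> Prop :=
  clos_refl_trans (mixed_graph T) switching_step.

Definition switching_equivalent M N : Prop :=
  switching_reachable M N \/ switching_reachable N M.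

End Switching.
End Graphs.

Coercion mixed_of_simple : simple_graph >-> mixed_graph.

Section Spectra.
Variable R : realType.

Definition omega (k : nat) : R[i] :=
  cos (2 * pi / k%:R) +i* sin (2 * pi / k%:R).

Definition hermitian_entry (T : finType) (k : nat) (M : mixed_graph T)
    (u v : T) : R[i] :=
  if darc M u v then omega k
  else if darc M v u then (omega k)^*
  else if uedge M u v then 1
  else 0.

(* The vertices are enumerated by [enum_val : 'I_#|T| -> T]. *)
Definition hermitian_adj (T : finType) (k : nat) (M : mixed_graph T) :
    'M[R[i]]_#|T| :=
  \matrix_(i, j) hermitian_entry k M (enum_val i) (enum_val j).

Definition eigenvalue_mult n (A : 'M[R[i]]_n) (a : R[i]) : nat :=
  mup a (char_poly A).

Definition cospectral (T : finType) (k : nat) (M N : mixed_graph T) : Prop :=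
  forall a : R[i], eigenvalue_mult (hermitian_adj k M) a =
                   eigenvalue_mult (hermitian_adj k N) a.

(* Only used for Hermitian matrices, all of whose eigenvalues are real. *)
Definition largest_eigenvalue n (A : 'M[R[i]]_n) (l : R) : Prop :=
  eigenvalue A l%:C /\ forall m : R, eigenvalue A m%:C -> m <= l.

Definition same_lambda1 (T : finType) (k : nat) (M N : mixed_graph T) : Prop :=
  exists l : R, largest_eigenvalue (hermitian_adj k M) l /\
                largest_eigenvalue (hermitian_adj k N) l.

End Spectra.

(* Main.v *)
Require Import Defs.
From Stdlib Require Import Relation_Operators.
From mathcomp Require Import all_boot all_order all_algebra.
From mathcomp Require Import complex reals trigo.
From mathcomp Require Import ring lra.

(** Conjugating [H(M)] by the diagonal matrix with entries [omega ^ p u] performs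
    the three-way switching along [p], and taking the converse transposes [H(M)];
    hence (d) implies (a). A partition as in (c) is admissible and switches [M] to
    [G] in one step. For (b) implies (c), let [x H(M) = l x] with [l] the common
    largest eigenvalue. Then [l |x|^2 = x H(M) x^* <= |x| A(G) |x|^T <= l |x|^2],
    so [|x|] is an eigenvector of [A(G)], positive by connectedness, and every
    term of the first inequality is tight. Thus [M] has all edges of [G], and the
    phases [s u = x u / |x u|] satisfy [s u * h u v = s v] along them; they are
    powers of [omega] up to a common factor, and the exponents are the partition. *)

Set Implicit Arguments.
Unset Strict Implicit.
Unset Printing Implicit Defensive.

Import Order.TTheory GRing.Theory Num.Theory.

Local Open Scope ring_scope.
Local Open Scope sesquilinear_scope.

(** * Hermitian matrices *)

Section HermitianMatrices.
Variables (C : numClosedFieldType) (n : nat).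
Implicit Types (A H : 'M[C]_n) (x y : 'rV[C]_n).

(** Row [i] of [spectralmx A] is an eigenvector. It is nonzero because that matrix is invertible. *)
Lemma eigenvalue_spectral_diag A i :
  A \is normalmx -> eigenvalue A (spectral_diag A 0 i).
Proof.
move=> /orthomx_spectralP defA; have uP := spectral_unit A.
apply/eigenvalueP; exists (delta_mx 0 i *m spectralmx A); last first.
  rewrite mulmx_free_eq0 ?row_free_unit //; apply/negP => /eqP/rowP/(_ i)/eqP.
  by rewrite !mxE !eqxx oner_eq0.
rewrite {2}defA -!mulmxA (mulKVmx uP) mulmxA scalemxAl; congr (_ *m _).
apply/rowP => j; rewrite mul_mx_diag !mxE eqxx /=.
by case: eqP => [->|_]; rewrite ?mul1r ?mulr1 ?mul0r ?mulr0.
Qed.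

Lemma row_mulmx_conj x y : (x *m y ^t*) 0 0 = \sum_i x 0 i * (y 0 i)^*.
Proof. by rewrite mxE; apply: eq_bigr => i _; rewrite !mxE. Qed.

(** * Rayleigh quotients below an upper bound [l] of the spectrum *)

Section Rayleigh.
Variables (A : 'M[C]_n) (l : C).
Hypothesis hA : A \is hermsymmx.
Hypothesis le_spec : forall i, spectral_diag A 0 i <= l.

Let P := spectralmx A.

(** The rows of the unitary [P] form an orthonormal eigenbasis. In the coordinates [x *m P ^t*], [A]
    acts diagonally. *)
Lemma spectral_coordinates x :
  l *: x - x *m A =
  \row_i ((l - spectral_diag A 0 i) * (x *m P ^t*) 0 i) *m P.
Proof.
have /orthomx_spectralP defA := hermitian_normalmx hA.
have uP := spectral_unitarymx A; set w := x *m P ^t*.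
have defx : x = w *m P by rewrite mulmxKtV.
have -> : x *m A = w *m diag_mx (spectral_diag A) *m P.
  by rewrite {1}defA invmx_unitary // !mulmxA.
rewrite {1}defx scalemxAl -mulmxBl; congr (_ *m P).
apply/rowP => i.
by rewrite mul_mx_diag !mxE mulrBl [_ * spectral_diag _ _ _]mulrC.
Qed.

(** As a sum of squares with weights [l - spectral_diag A 0 i >= 0], the defect is visibly
    nonnegative, and its vanishing can be read off term by term. *)
Lemma rayleigh_defect x :
  ((l *: x - x *m A) *m x ^t*) 0 0 =
  \sum_i (l - spectral_diag A 0 i) * `|(x *m P ^t*) 0 i| ^+ 2.
Proof.
rewrite spectral_coordinates -mulmxA.
have -> : P *m x ^t* = (x *m P ^t*) ^t*.
  by rewrite trmx_mul map_mxM /= trmxCK.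
by rewrite row_mulmx_conj; apply: eq_bigr => i _; rewrite mxE normCK mulrA.
Qed.

Let defect_term_ge0 x i :
  0 <= (l - spectral_diag A 0 i) * `|(x *m P ^t*) 0 i| ^+ 2.
Proof. by rewrite mulr_ge0 ?subr_ge0 ?exprn_ge0. Qed.

Lemma rayleigh_defect_ge0 x : 0 <= ((l *: x - x *m A) *m x ^t*) 0 0.
Proof. by rewrite rayleigh_defect sumr_ge0. Qed.

(** Each term vanishes, so every coordinate of [x] is zero or belongs to an eigenvalue equal to
    [l]. *)
Lemma rayleigh_defect_eq0 x :
  ((l *: x - x *m A) *m x ^t*) 0 0 = 0 -> x *m A = l *: x.
Proof.
rewrite rayleigh_defect => /psumr_eq0P term0.
apply/esym/eqP; rewrite -subr_eq0 spectral_coordinates.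
apply/eqP; rewrite [X in X *m _](_ : _ = 0) ?mul0mx //.
apply/rowP => i; rewrite [LHS]mxE [RHS]mxE; apply/eqP.
have /eqP := term0 (fun i _ => defect_term_ge0 x i) i isT.
by rewrite mulf_eq0 sqrf_eq0 normr_eq0 -mulf_eq0.
Qed.

(** On an eigenvector [x] for [m] the defect equals [(l - m) |x|^2]. *)
Lemma eigenvalue_le_spectral_bound m : eigenvalue A m -> m <= l.
Proof.
move=> /eigenvalueP[x xA x0]; have := rayleigh_defect_ge0 x.
rewrite xA -scalerBl -scalemxAl mxE row_mulmx_conj.
under eq_bigr do rewrite -normCK.
rewrite pmulr_lge0 ?subr_ge0 // lt_def sumr_ge0 ?andbT; last first.
  by move=> i _; rewrite exprn_ge0.
apply: contraNN x0 => /eqP/psumr_eq0P sum0; apply/eqP/rowP => i; rewrite mxE.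
by apply/eqP; rewrite -normr_eq0 -sqrf_eq0 sum0 // => j _; rewrite exprn_ge0.
Qed.

(* Equality in Wielandt's comparison: both inequalities in
   [l |x|^2 = x H x^* <= |x| A |x|^T <= l |x|^2] are tight. *)
Lemma wielandt_equality H x (y := \row_i `|x 0 i|) :
    l \is Num.real -> (forall i j, `|H i j| <= A i j) -> x *m H = l *: x ->
  y *m A = l *: y /\
  forall i j, x 0 i * H i j * (x 0 j)^* = `|x 0 i| * A i j * `|x 0 j|.
Proof.
move=> lreal le_HA xH.
pose z i j := x 0 i * H i j * (x 0 j)^*.
pose b i j := `|x 0 i| * A i j * `|x 0 j|.
have le_zb i j : `|z i j| <= b i j.
  by rewrite /z /b !normrM norm_conjC ler_wpM2r // ler_wpM2l.
have le_Rezb i j : 'Re (z i j) <= b i j.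
  exact: le_trans (leif_Re_Creal _).1 (le_zb i j).
pose s := \sum_i `|x 0 i| ^+ 2.
have form (B : 'M[C]_n) (v : 'rV[C]_n) :
    ((v *m B) *m v ^t*) 0 0 = \sum_j \sum_i v 0 i * B i j * (v 0 j)^*.
  by rewrite row_mulmx_conj; apply: eq_bigr => j _; rewrite mxE mulr_suml.
(* Single terms [z i j] need not be real, but their sum [l * s] is, so they can be replaced by their
   real parts and compared with [b i j] one by one. *)
have sumz : \sum_j \sum_i 'Re (z i j) = l * s.
  have := form H x; rewrite xH -scalemxAl mxE row_mulmx_conj.
  under eq_bigr do rewrite -normCK.
  rewrite -/s => ls; have /Creal_ReP <- : l * s \is Num.real.
    by rewrite realM // ger0_real // sumr_ge0 // => i _; rewrite exprn_ge0.
  by rewrite ls raddf_sum; apply: eq_bigr => j _; rewrite raddf_sum.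
have yyE : (y *m y ^t*) 0 0 = s.
  rewrite row_mulmx_conj; apply: eq_bigr => i _.
  by rewrite !mxE conj_normC expr2.
have sumb : ((l *: y - y *m A) *m y ^t*) 0 0 = l * s - \sum_j \sum_i b i j.
  rewrite mulmxBl -scalemxAl mxE [X in X + _]mxE yyE [X in _ + X]mxE form.
  congr (_ - _).
  apply: eq_bigr => j _; apply: eq_bigr => i _.
  by rewrite !mxE conj_normC.
have le_sum j : \sum_i 'Re (z i j) <= \sum_i b i j by apply: ler_sum.
(* The total slack is nonnegative termwise, and by [sumb] it is the opposite of a Rayleigh defect,
   hence also nonpositive. *)
have eq_sum : \sum_j (\sum_i b i j - \sum_i 'Re (z i j)) = 0.
  rewrite sumrB sumz; apply/eqP; rewrite eq_le -subr_ge0 opprB add0r -sumb.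
  rewrite rayleigh_defect_ge0 -sumz /= subr_ge0; exact: ler_sum.
split.
  apply: rayleigh_defect_eq0; rewrite sumb.
  by move: eq_sum; rewrite sumrB sumz => /subr0_eq ->; rewrite subrr.
move=> i j.
have subj_ge0 j' : 0 <= \sum_i b i j' - \sum_i 'Re (z i j') by rewrite subr_ge0.
have sub_ge0 i' : 0 <= b i' j - 'Re (z i' j) by rewrite subr_ge0.
have := psumr_eq0P (fun j' _ => subj_ge0 j') eq_sum => /(_ j isT).
rewrite -sumrB => /(psumr_eq0P (fun i' _ => sub_ge0 i'))/(_ i isT)/eqP.
rewrite subr_eq0 => /eqP bE.
(* From ['Re z = b] and ['Re z <= |z| <= b] all three agree, and ['Re z = |z|] holds only for
   [z >= 0]. *)
have zE : `|z i j| = b i j.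
  by apply/le_anti; rewrite le_zb bE (leif_Re_Creal _).1.
have z_ge0 : 0 <= z i j.
  by rewrite -(leif_Re_Creal _).2 zE bE.
by rewrite -/(z i j) -/(b i j) -zE ger0_norm.
Qed.

End Rayleigh.
End HermitianMatrices.

(** Conjugate the identity and clear the inverse powers of [z]. This carries a switching identity
    from the entry [(u, v)] to the entry [(v, u)]. *)
Lemma conj_balance (C : numClosedFieldType) (z a b : C) m n :
    z != 0 -> z^* = z^-1 ->
  z ^+ m * a = b * z ^+ n -> z ^+ n * a^* = b^* * z ^+ m.
Proof.
move=> z0 zC /(congr1 (@Num.conj _)); rewrite !rmorphM !rmorphXn /= zC !exprVn.
move=> ab; apply: (mulfI (invr_neq0 (expf_neq0 m z0))).
by rewrite mulrCA ab mulrCA divff ?expf_neq0 // mulr1 mulrCA mulVf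
  ?expf_neq0 // mulr1.
Qed.

(** Cancel [b^*] using [b * b^* = |b|^2]: the hypothesis says that [z] rotates the direction of [a]
    onto that of [b]. *)
Lemma phase_transport (C : numClosedFieldType) (a b z : C) :
    a != 0 -> b != 0 -> a * z * b^* = `|a| * `|b| ->
  a / `|a| * z = b / `|b|.
Proof.
move=> a0 b0 ab; have b0' : b^* != 0 by rewrite conjC_eq0.
apply: (mulIf b0'); rewrite [RHS]mulrAC -normCK expr2 mulfK ?normr_eq0 //.
by rewrite (mulrAC a) (mulrAC (a * z)) ab [`|a| * _]mulrC mulfK ?normr_eq0.
Qed.

(** * Characteristic polynomials under transposition and diagonal conjugation *)

Section CharPoly.
Variables (F : fieldType) (n : nat).

Lemma char_poly_trmx (A : 'M[F]_n) : char_poly A^T = char_poly A.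
Proof.
rewrite /char_poly -[RHS]det_tr /char_poly_mx linearB /= tr_scalar_mx.
by rewrite map_trmx.
Qed.

(** With [D] the diagonal matrix of [d], [D (X - B) = (X - A) D]. Taking determinants and cancelling
    the nonzero [det D] avoids inverting [D]. *)
Lemma char_poly_diag_conj (A B : 'M[F]_n) (d : 'rV[F]_n) :
    (forall i, d 0 i != 0) ->
    (forall i j, d 0 i * B i j = A i j * d 0 j) ->
  char_poly B = char_poly A.
Proof.
move=> ud dBA; pose D : 'M[{poly F}]_n := map_mx polyC (diag_mx d).
have eqD : D *m char_poly_mx B = char_poly_mx A *m D.
  rewrite /char_poly_mx mulmxBr mulmxBl scalar_mxC -!map_mxM.
  congr (_ - map_mx _ _).
  by apply/matrixP => i j; rewrite mul_diag_mx mul_mx_diag !mxE.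
have := congr1 determinant eqD; rewrite !det_mulmx mulrC.
apply: mulIf; rewrite det_map_mx polyC_eq0 det_diag.
by apply/prodf_neq0 => i _.
Qed.

Lemma eigenvalue_mup (A : 'M[F]_n) a :
  eigenvalue A a = (0 < mup a (char_poly A))%N.
Proof.
rewrite eigenvalue_root_char -XsubC_dvd ?monic_neq0 ?char_poly_monic //.
by rewrite dvdp_XsubCl.
Qed.

End CharPoly.

(** * The root of unity [omega k] *)

Section Omega.
Variable R : realType.
Local Open Scope complex_scope.

Lemma cos_sin_expr (t : R) m :
  (cos t +i* sin t) ^+ m = cos (t *+ m) +i* sin (t *+ m).
Proof.
elim: m => [|m IHm]; first by rewrite expr0 mulr0n cos0 sin0.
rewrite exprS IHm mulrS cosD sinD; simpc.
by congr (_ +i* _); rewrite [in RHS]addrC.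
Qed.

Variable k : nat.
Hypothesis k_gt0 : (0 < k)%N.

Let k_neq0 : k%:R != 0 :> R. Proof. by rewrite pnatr_eq0 -lt0n. Qed.

Lemma omega_prim_root : k.-primitive_root (omega R k).
Proof.
apply/andP; split=> //; apply/forallP => i; apply/eqP.
rewrite unity_rootE cos_sin_expr.
case: (ltngtP i.+1 k) => [lt_ik||->]; last 2 first.
- by rewrite ltnNge ltn_ord.
- by rewrite -[_ *+ k]mulr_natr divfK // mulr_natl cos2pi sin2pi eqxx.
apply/negbTE/eqP => -[cos1 _].
(* Half of the angle of [omega ^ i.+1]: [cos (2 t) = 1] would force [sin t = 0], whereas
   [0 < t < pi]. *)
pose t : R := pi * i.+1%:R / k%:R.
have t2 : 2 * pi / k%:R *+ i.+1 = t *+ 2.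
  by rewrite /t -[LHS]mulr_natr -[RHS]mulr_natr; ring.
have : 0 < sin t.
  apply: sin_gt0_pi; rewrite /t -mulrA pmulr_rgt0 ?pi_gt0 // divr_gt0 ?ltr0n //=.
  by rewrite -[ltRHS]mulr1 ltr_pM2l ?pi_gt0 // ltr_pdivrMr ?ltr0n // mul1r ltr_nat.
move: cos1; rewrite t2 cos_mulr2n cos2sin2 => cos1 sin_gt0.
have : sin t ^+ 2 = 0 by lra.
by move/eqP; rewrite sqrf_eq0 gt_eqF.
Qed.

Lemma omega_neq0 : omega R k != 0.
Proof.
apply/eqP => w0; have /eqP := prim_expr_order omega_prim_root.
by rewrite w0 expr0n gtn_eqF // eq_sym oner_eq0.
Qed.

Lemma omega_conj : ((omega R k)^* = (omega R k)^-1)%R.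
Proof.
apply: (mulfI omega_neq0); rewrite divff ?omega_neq0 //.
rewrite -[LHS]/(omega R k * (omega R k)^*)%C /omega; simpc.
by rewrite -!expr2 cos2Dsin2 [sin _ * _]mulrC addrC subrr.
Qed.

Lemma omega_norm : `|omega R k| = 1.
Proof. by rewrite normc_def /= cos2Dsin2 sqrtr1. Qed.

End Omega.

(** * Switching preserves the spectrum *)

Section HermitianAdjacency.
Variables (R : realType) (k : nat) (T : finType).
Implicit Types (G : simple_graph T) (M : mixed_graph T).
Hypothesis k_gt0 : (0 < k)%N.

Local Notation w := (omega R k).
Local Notation h := (hermitian_entry R k).

Lemma hermitian_entryE M u v :
  h M u v =
  if darc M u v then w else if darc M v u then w^-1 else (uedge M u v)%:R.
Proof.
rewrite -omega_conj // /hermitian_entry.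
by case: ifP => _; [|case: ifP => _; [|case: ifP]].
Qed.

Lemma hermitian_entryC M u v : h M v u = (h M u v)^*.
Proof.
rewrite !hermitian_entryE (uedge_sym M v u).
have [uv|] := boolP (darc M u v).
  by rewrite (negbTE (darc_asym uv)) omega_conj.
by case: ifP => _ _; rewrite ?conjC_nat // -omega_conj // conjCK.
Qed.

Lemma hermitian_adj_hermsym M : hermitian_adj R k M \is hermsymmx.
Proof.
apply/is_hermitianmxP; rewrite expr0 scale1r; apply/matrixP => i j.
by rewrite !mxE hermitian_entryC.
Qed.

Lemma hermitian_entry_simple G u v : h G u v = (adj G u v)%:R.
Proof. by rewrite hermitian_entryE. Qed.

Lemma norm_hermitian_entry M u v : `|h M u v| = (underlying_adj M u v)%:R.
Proof.
rewrite hermitian_entryE /underlying_adj.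
case: ifP => _; first by rewrite orbT omega_norm.
case: ifP => _; first by rewrite !orbT normfV omega_norm ?invr1.
by rewrite !orbF normr_nat.
Qed.

End HermitianAdjacency.

Section Switching.
Variables (R : realType) (k : nat) (T : finType).
Implicit Types (G : simple_graph T) (M N : mixed_graph T) (p : T -> 'I_k).
Hypothesis k_ge3 : (3 <= k)%N.

Local Notation w := (omega R k).
Local Notation h := (hermitian_entry R k).

Let k_gt0 : (0 < k)%N. Proof. exact: leq_trans k_ge3. Qed.
Let w_neq0 : w != 0. Proof. exact: omega_neq0. Qed.

(** Since [k >= 3], the residues 0, 1, 2 are distinct modulo [k], so the rules of a switching never
    overlap. *)
Lemma part_diff_excl p u v c d :
  part_diff p u v c -> (c < 3)%N -> (d < 3)%N -> c != d ->
  part_diff p u v d = false.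
Proof.
rewrite /part_diff => /eqP -> c3 d3 /negbTE cd; rewrite eqn_modDl.
by rewrite !modn_small ?(leq_trans c3) ?(leq_trans d3).
Qed.

Lemma part_diff0C p u v : part_diff p u v 0 = part_diff p v u 0.
Proof. by rewrite /part_diff !addn0 eq_sym. Qed.

Lemma part_diff_expr p u v d :
  part_diff p u v d -> w ^+ p u = w ^+ p v * w ^+ d.
Proof.
rewrite /part_diff -(eq_prim_root_expr (omega_prim_root R k_gt0)) exprD.
by move/eqP.
Qed.

(** Entrywise form of [D H(N) = H(M) D], where [D] is diagonal with entries [w ^+ p u]. Each arc or
    edge is checked in one direction; conjugation gives the other. *)
Lemma hermitian_entry_switch p M N u v :
  three_way_switching p M N -> w ^+ p u * h N u v = h M u v * w ^+ p v.
Proof.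
move=> [[admU admD] eqU eqD].
have arc x y : darc M x y -> w ^+ p x * h N x y = h M x y * w ^+ p y.
  move=> xy; have nyx := negbTE (darc_asym xy).
  have nuxy : uedge M x y = false.
    by apply/negP => /uedge_not_darc; rewrite xy.
  have nuyx : uedge M y x = false by rewrite uedge_sym.
  rewrite !hermitian_entryE // xy !eqD eqU xy nyx nuxy nuyx /= !orbF.
  (* For part difference 0, 1 or 2 the arc is kept, made undirected or reversed, so the new entry is
     [w], 1 or [w^-1]. It compensates the factor 1, [w] or [w ^+ 2]. *)
  case/or3P: (admD _ _ xy) => d; rewrite (part_diff_expr d).
  - have -> : part_diff p x y 1 = false by apply: part_diff_excl d _ _ _.
    have -> : part_diff p x y 2 = false by apply: part_diff_excl d _ _ _.
    by rewrite expr0 mulr1 mulrC.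
  - have -> : part_diff p x y 2 = false by apply: part_diff_excl d _ _ _.
    by rewrite d /= expr1 mulr1 mulrC.
  - have -> : part_diff p x y 1 = false by apply: part_diff_excl d _ _ _.
    by rewrite d /= expr2 -!mulrA divff // mulr1 mulrC.
have conj_eq x y :
    w ^+ p x * h N x y = h M x y * w ^+ p y ->
    w ^+ p y * h N y x = h M y x * w ^+ p x.
  rewrite (hermitian_entryC R k_gt0 N x y) (hermitian_entryC R k_gt0 M x y).
  by apply: conj_balance => //; apply: omega_conj.
have [/arc //|nuv] := boolP (darc M u v).
have [/arc/conj_eq //|nvu] := boolP (darc M v u).
have edge x y : uedge M x y -> ~~ darc M x y -> ~~ darc M y x ->
    part_diff p y x 1 -> w ^+ p x * h N x y = h M x y * w ^+ p y.
  move=> xy /negbTE nxy /negbTE nyx d.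
  by rewrite !hermitian_entryE // eqD xy nxy nyx d (part_diff_expr d) mul1r.
have [uv|nuuv] := boolP (uedge M u v); last first.
  rewrite !hermitian_entryE // !eqD eqU (uedge_sym M v u).
  by rewrite (negbTE nuv) (negbTE nvu) (negbTE nuuv) /= mulr0 mul0r.
case/or3P: (admU _ _ uv) => d.
- have d' : part_diff p u v 0 by rewrite part_diff0C.
  rewrite !hermitian_entryE // !eqD eqU (uedge_sym M v u) uv.
  rewrite (negbTE nuv) (negbTE nvu) /=.
  have -> : part_diff p v u 1 = false by apply: part_diff_excl d _ _ _.
  have -> : part_diff p u v 1 = false by apply: part_diff_excl d' _ _ _.
  by rewrite /= (part_diff_expr d) expr0 !mulr1 mul1r.
- exact: edge.
- by apply/conj_eq/edge; rewrite // uedge_sym.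
Qed.

Lemma switching_step_char_poly M N : switching_step k M N ->
  char_poly (hermitian_adj R k M) = char_poly (hermitian_adj R k N).
Proof.
case=> [[p sw]|[eqU eqD]].
  apply/esym/(@char_poly_diag_conj _ _ _ _ (\row_i w ^+ p (enum_val i))).
    by move=> i; rewrite mxE expf_neq0.
  by move=> i j; rewrite !mxE (hermitian_entry_switch _ _ sw).
rewrite -char_poly_trmx; congr char_poly; apply/matrixP => i j.
by rewrite !mxE !hermitian_entryE // eqU !eqD (uedge_sym M).
Qed.

Lemma switching_reachable_char_poly M N : switching_reachable k M N ->
  char_poly (hermitian_adj R k M) = char_poly (hermitian_adj R k N).
Proof.
by elim=> [M1 N1 /switching_step_char_poly|//|M1 M2 M3 _ -> _ ->].
Qed.

Lemma switching_equivalent_cospectral M N :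
  switching_equivalent k M N -> cospectral R k M N.
Proof.
move=> [] /switching_reachable_char_poly eqMN a;
  by rewrite /eigenvalue_mult eqMN.
Qed.

Lemma partition_switching p G M :
    same_graph (underlying M) G ->
    (forall u v, uedge M u v -> p u = p v) ->
    (forall u v, darc M u v -> (p u = p v + 1 %[mod k])%N) ->
  three_way_switching p M G.
Proof.
move=> eqG pU pD.
have d1 x y : darc M x y -> part_diff p x y 1 by move=> /pD/eqP.
have d0 x y : uedge M x y -> part_diff p x y 0.
  by move=> /pU pxy; rewrite /part_diff pxy addn0.
have n1 x y : uedge M x y -> part_diff p x y 1 = false.
  by move=> /d0 d; apply: part_diff_excl d _ _ _.
have n2 x y : darc M x y -> part_diff p x y 2 = false.
  by move=> /d1 d; apply: part_diff_excl d _ _ _.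
split=> [|x y|x y].
- by split=> x y => [/d0 | /d1] d; rewrite ?(part_diff0C p y x) d ?orbT.
- rewrite -[LHS](eqG x y) /= /underlying_adj; congr [|| _, _ | _].
  + by case xy: (uedge M x y); rewrite //= !n1 // uedge_sym.
  + by case xy: (darc M x y); rewrite //= d1.
  + by case xy: (darc M y x); rewrite //= d1.
(* [G] has no arcs, so each of the three sources of an arc after switching must be ruled out. *)
- apply/esym/negP => /or3P[/andP[xy]|/and3P[/d1 -> //]|/andP[/n2 -> //]].
  by rewrite n1 // uedge_sym.
Qed.

End Switching.

(** * Largest eigenvalues *)

Section LargestEigenvalue.
Variables (R : realType) (k : nat) (T : finType).
Implicit Types (G : simple_graph T) (M N : mixed_graph T).
Local Open Scope complex_scope.

Lemma hermitian_largest_eigenvalue n (A : 'M[R[i]]_n) :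
  (0 < n)%N -> A \is hermsymmx -> exists l : R, largest_eigenvalue A l.
Proof.
case: n A => // n A _ hA.
have /mxOverP sreal := hermitian_spectral_diag_real hA.
pose d i := complex.Re (spectral_diag A 0 i).
have dE i : (d i)%:C = spectral_diag A 0 i by rewrite RRe_real.
pose i0 := [arg max_(i > ord0) d i]%O.
have dmax j : d j <= d i0 by rewrite /i0; case: arg_maxP => // i _; apply.
exists (d i0); split.
  by rewrite dE eigenvalue_spectral_diag ?hermitian_normalmx.
move=> m /(eigenvalue_le_spectral_bound hA) le_m.
by rewrite -lecR; apply: le_m => i; rewrite -dE lecR.
Qed.

(** [largest_eigenvalue] bounds real eigenvalues only, so the diagonal entries must first be
    recognised as real. *)
Lemma largest_eigenvalue_spectral_le n (A : 'M[R[i]]_n) (l : R) i :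
  A \is hermsymmx -> largest_eigenvalue A l -> spectral_diag A 0 i <= l%:C.
Proof.
move=> hA [_ lmax]; have /mxOverP sreal := hermitian_spectral_diag_real hA.
rewrite -[spectral_diag _ _ _]RRe_real ?lecR //; apply: lmax.
by rewrite RRe_real // eigenvalue_spectral_diag ?hermitian_normalmx.
Qed.

Lemma cospectral_eigenvalue M N a : cospectral R k M N ->
  eigenvalue (hermitian_adj R k M) a = eigenvalue (hermitian_adj R k N) a.
Proof.
move=> /(_ a); rewrite /eigenvalue_mult => eqMN.
apply: etrans (eigenvalue_mup _ _) _; apply/esym.
by apply: etrans (eigenvalue_mup _ _) _; apply/esym/(congr1 (leq 1)).
Qed.

Lemma cospectral_same_lambda1 M N :
  (0 < k)%N -> (0 < #|T|)%N -> cospectral R k M N -> same_lambda1 R k M N.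
Proof.
move=> k_gt0 T_gt0 cosp.
have [l lM] := hermitian_largest_eigenvalue T_gt0 (hermitian_adj_hermsym R k_gt0 M).
exists l; split; first exact: lM.
case: lM => el lmax; split=> [|m]; rewrite -(cospectral_eigenvalue _ cosp).
  exact: el.
exact: lmax.
Qed.

Lemma same_lambda1_phases G M : (0 < k)%N ->
    connected_graph G -> spanning_subgraph (underlying M) G ->
    same_lambda1 R k G M ->
  exists s : T -> R[i], (forall u, s u != 0) /\
    forall u v, adj G u v -> s u * hermitian_entry R k M u v = s v.
Proof.
move=> k_gt0 [_ connG] subG [l [lG [/eigenvalueP[x xH x0] _]]].
set A := hermitian_adj R k G; set H := hermitian_adj R k M in xH.
have hA : A \is hermsymmx := hermitian_adj_hermsym R k_gt0 G.
have le_HA i j : `|H i j| <= A i j.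
  rewrite !mxE norm_hermitian_entry // hermitian_entry_simple // ler_nat.
  have := subG (enum_val i) (enum_val j); rewrite /=.
  by case: underlying_adj => // ->.
have le_spec i := largest_eigenvalue_spectral_le i hA lG.
have lreal : l%:C \is Num.real by rewrite complex_real.
have [yA phase] := wielandt_equality hA le_spec lreal le_HA xH.
pose X u := x 0 (enum_rank u).
have AE u v : A (enum_rank u) (enum_rank v) = (adj G u v)%:R.
  by rewrite mxE !enum_rankK hermitian_entry_simple.
have HE u v : H (enum_rank u) (enum_rank v) = hermitian_entry R k M u v.
  by rewrite mxE !enum_rankK.
(* Where [|x|] vanishes, its eigenvalue equation is a vanishing sum of nonnegative terms, so [x]
   vanishes at all neighbours too. *)
have X0_closed u v : adj G u v -> X u = 0 -> X v = 0.
  move=> uv Xu0; have /rowP/(_ (enum_rank u)) := yA.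
  rewrite !mxE -/(X u) Xu0 normr0 mulr0 => /psumr_eq0P term0.
  have := term0 _ (enum_rank v) isT; rewrite AE adj_sym uv mxE mulr1.
  move=> Xv0; apply/eqP; rewrite -normr_eq0; apply/eqP/Xv0 => i _.
  by rewrite mxE mulr_ge0 // (le_trans _ (le_HA _ _)).
have X_neq0 u : X u != 0.
  apply: contraNneq x0 => Xu0; apply/eqP/rowP => i; rewrite mxE -(enum_valK i).
  have Xclosed : closed (adj G) [pred v | X v == 0].
    apply: intro_closed; first exact/sym_connect_sym/adj_sym.
    by move=> a b /X0_closed Xab /eqP/Xab; rewrite !inE => ->.
  apply/eqP; have := closed_connect Xclosed (connG u (enum_val i)).
  by rewrite !inE Xu0 eqxx.
exists (fun u => X u / `|X u|); split=> [u|u v uv].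
  by rewrite mulf_neq0 ?invr_neq0 ?normr_eq0.
apply: phase_transport => //.
by have := phase (enum_rank u) (enum_rank v); rewrite HE AE uv mulr1.
Qed.

Lemma same_lambda1_partition G M : (0 < k)%N ->
    connected_graph G -> spanning_subgraph (underlying M) G ->
    same_lambda1 R k G M ->
  same_graph (underlying M) G /\
  exists p : T -> 'I_k,
    (forall u v, uedge M u v -> p u = p v) /\
    (forall u v, darc M u v -> (p u = p v + 1 %[mod k])%N).
Proof.
move=> k_gt0 conn subG same.
have [s [s_neq0 phase]] := same_lambda1_phases k_gt0 conn subG same.
have w_prim := omega_prim_root R k_gt0; set w := omega R k in w_prim.
case: conn => T_gt0 connG.
have eqG : same_graph (underlying M) G.
  move=> u v; apply/idP/idP; first exact: subG.
  (* An edge of [G] missing from [M] has entry 0, which would make [s v] zero. *)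
  move=> /phase; apply: contraPT => /= nuv; apply/eqP.
  suff -> : hermitian_entry R k M u v = 0 by rewrite mulr0 eq_sym.
  by apply/eqP; rewrite -normr_eq0 norm_hermitian_entry // (negbTE nuv).
have sU u v : uedge M u v -> s u = s v.
  move=> uv; rewrite -(phase u v) -?eqG /= /underlying_adj ?uv //.
  rewrite hermitian_entryE // uv (negbTE (uedge_not_darc uv)).
  by rewrite (negbTE (uedge_not_darc _)) ?mulr1 // uedge_sym.
have sD u v : darc M u v -> s u * w = s v.
  move=> uv; rewrite -(phase u v) -?eqG /= /underlying_adj ?uv ?orbT //.
  by rewrite hermitian_entryE // uv.
case/card_gt0P: T_gt0 => r _.
(* The vertices whose phase differs from that of the root [r] by a power of [w]. The power
   multiplies [s u], not [s r], so that the exponent drops by 1 along an arc, as the partition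
   requires. *)
pose a : {pred T} := [pred u | [exists q : 'I_k, s u * w ^+ q == s r]].
have aP u m : s u * w ^+ m = s r -> u \in a.
  move=> um; apply/existsP; exists (Ordinal (ltn_pmod m k_gt0)) => /=.
  by rewrite (prim_expr_mod w_prim) um.
have a_closed : closed (adj G) a.
  apply: intro_closed; first exact/sym_connect_sym/adj_sym.
  move=> u v; rewrite -eqG => /or3P[/sU|/sD|/sD] suv /existsP[q /eqP squ].
  - by apply: (aP _ q); rewrite -suv.
  (* Subtracting 1 from [q] could leave the naturals; adding [k.-1] has the same effect, as
     [w ^+ k = 1]. *)
  - apply: (aP _ (q + k.-1)%N); rewrite -suv -mulrA -exprS -addnS prednK //.
    by rewrite exprD (prim_expr_order w_prim) mulr1.
  - by apply: (aP _ q.+1); rewrite exprS mulrA suv.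
have ex_exponent u : exists q : 'I_k, s u * w ^+ q = s r.
  have : u \in a.
    by rewrite -(closed_connect a_closed (connG r u)) (aP _ 0%N) ?mulr1.
  by move=> /existsP[q /eqP]; exists q.
have [p pE] := fin_all_exists ex_exponent.
split=> //; exists p; split=> u v.
  move=> /sU suv; apply/val_inj/eqP => /=.
  rewrite -(modn_small (ltn_ord (p u))) -(modn_small (ltn_ord (p v))).
  rewrite -(eq_prim_root_expr w_prim); apply/eqP/(mulfI (s_neq0 u)).
  by rewrite pE suv pE.
move=> /sD suv; apply/eqP; rewrite -(eq_prim_root_expr w_prim).
by apply/eqP/(mulfI (s_neq0 u)); rewrite pE -(pE v) -suv addn1 exprS mulrA.
Qed.

End LargestEigenvalue.

Theorem theorem2p9 (R : realType) (k : nat) (T : finType)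
    (G : simple_graph T) (M : mixed_graph T) :
  (3 <= k)%N ->
  connected_graph G ->
  spanning_subgraph (underlying M) G ->
  [<-> cospectral R k G M;
       same_lambda1 R k G M;
       same_graph (underlying M) G /\
       exists p : T -> 'I_k,
         (forall u v : T, uedge M u v -> p u = p v) /\
         (forall u v : T, darc M u v -> (p u = p v + 1 %[mod k])%N);
       switching_equivalent k G M].
Proof.
move=> k_ge3 connG subG; have k_gt0 : (0 < k)%N by apply: leq_trans k_ge3.
tfae.
- by apply: cospectral_same_lambda1 => //; case: connG.
- exact: same_lambda1_partition.
(* The switching leads from [M] to [G], hence the second disjunct. *)
- move=> [eqG [p [pU pD]]]; right; apply: rt_step; left; exists p.
  exact: partition_switching.
- exact: switching_equivalent_cospectral.
Qed.
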